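(* Let $t\ge1$, $G=\mathbb{Z}_{4t+2}$, and let $\psi=\gamma\prod_{j=1}^w\partial_{i_j}$ where $i_1,\ldots,i_w$ are distinct elements of $\{2,\ldots,4t+1\}$. If $\psi$ is quasi-orthogonal then $t\le w\le 3t+1$.
   Context: Index the elements $0,1,\ldots,4t+1$ of $G$ by $1,\ldots,4t+2$. $\gamma(j,k)=(-1)^{\lfloor (j+k)/(4t+2)\rfloor}$ for $j,k\in\{0,\ldots,4t+1\}$. For $2\le i\le 4t+2$, $\partial_i(x,y)=\delta_i(x)\delta_i(y)\delta_i(x+y)$ where $\delta_i:G\to\{\pm1\}$ is $-1$ at the element with index $i$ (i.e. $i-1$) and $1$ elsewhere. Products of cocycles are pointwise. For a normalized cocycle $\psi$ with matrix $M_\psi=[\psi(g,h)]$, $RE(M_\psi)=\sum_{g\ne0}|\sum_h\psi(g,h)|$; since $\psi$ here is not a coboundary, it is quasi-orthogonal iff $RE(M_\psi)=4t$. *)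

(* Defs.v *)
From mathcomp Require Import all_boot all_order all_algebra.

Set Implicit Arguments.
Unset Strict Implicit.
Unset Printing Implicit Defensive.

Import Order.TTheory GRing.Theory Num.Theory.
Local Open Scope ring_scope.

Section Cocycles.
Variable G : finZmodType.
Implicit Types (psi : G -> G -> int) (phi : G -> int).

Definition sign_valued (T : Type) (f : T -> int) := forall x, f x = 1 \/ f x = -1.

Definition normalized_cocycle psi :=
  [/\ forall x, sign_valued (psi x),
      forall x, psi x 0 = 1 /\ psi 0 x = 1
    & forall x y z, psi x y * psi (x + y) z = psi x (y + z) * psi y z].

(* phi^-1 = phi for values in {1, -1}. *)
Definition cobound phi : G -> G -> int := fun x y => phi x * phi y * phi (x + y).

Definition is_coboundary psi :=
  exists2 phi : G -> int, sign_valued phi & forall x y, psi x y = cobound phi x y.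

Definition row_excess psi : int := \sum_(g : G | g != 0) `|\sum_(h : G) psi g h|.

(* Meaningful when #|G| = 4t+2: the row excess of a normalized cocycle is at
   least 4t, and at least 8t+2 for a coboundary; quasi-orthogonal cocycles are
   those that meet the relevant bound. *)
Definition quasi_orthogonal (t : nat) psi :=
  [/\ normalized_cocycle psi,
      is_coboundary psi -> row_excess psi = (8 * t + 2)%N
    & ~ is_coboundary psi -> row_excess psi = (4 * t)%N].

End Cocycles.

(* The nat coercion of an element of 'Z_n is its representative in 0..n-1, so
   j + k below is the sum in nat. *)
Definition gamma (n : nat) : 'Z_n -> 'Z_n -> int :=
  fun j k => (-1) ^+ ((j + k)%N %/ n).

(* Elements are indexed from 1: the element x has index x.+1. *)
Definition delta (n i : nat) : 'Z_n -> int :=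
  fun x => if x.+1 == i then -1 else 1.

Definition elem_cobound (n i : nat) : 'Z_n -> 'Z_n -> int := cobound (delta i).

Definition gamma_prod (n w : nat) (i : 'I_w -> nat) : 'Z_n -> 'Z_n -> int :=
  fun x y => gamma x y * \prod_(j < w) elem_cobound (i j) x y.

(* Main.v *)
Require Import Defs.
From mathcomp Require Import all_boot all_order all_algebra.
From mathcomp Require Import zify ring.

Set Implicit Arguments.
Unset Strict Implicit.
Unset Printing Implicit Defensive.

Import Order.TTheory GRing.Theory Num.Theory.
Local Open Scope ring_scope.

(** Let [n = 4t+2] and write [psi = gamma * cobound phi].  Row [g] of [psi] has
    product [(-1)^g]; as it consists of [n] signs, its sum is congruent to [2]
    modulo [4] when [g] is even.  The [2t] nonzero even rows therefore already
    contribute [4t] to the row excess, so a row excess of [4t] forces the odd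
    rows, and in particular row [1], to have sum zero.  Now [gamma 1] is [1]
    except at [-1], so this fixes the correlation of [phi] with its shift by
    [1].  Finally, expanding the nonnegative sums over [h] of
    [(1 + phi h) * (1 + phi (1 + h))] and [(1 - phi h) * (1 - phi (1 + h))]
    turns that correlation into bounds for [\sum_h phi h = n - 2w]. *)

Definition is_sign (a : int) := a = 1 \/ a = -1.

Lemma is_signN a : is_sign a -> is_sign (- a).
Proof. by case=> ->; [right | left]. Qed.

Lemma is_signM a b : is_sign a -> is_sign b -> is_sign (a * b).
Proof. by move=> [] -> [] ->; [left | right | right | left]. Qed.

Lemma is_signX a m : is_sign a -> is_sign (a ^+ m).
Proof.
by move=> sa; elim: m => [|m IHm]; [left | rewrite exprS; apply: is_signM].
Qed.

Lemma is_sign_prod (I : Type) (r : seq I) (P : pred I) (F : I -> int) :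
  sign_valued F -> is_sign (\prod_(i <- r | P i) F i).
Proof. by move=> sF; elim/big_ind: _; [left | exact: is_signM | move=> *]. Qed.

Lemma is_sign_mulrr a : is_sign a -> a * a = 1.
Proof. by case=> ->. Qed.

Lemma is_sign_exp_even a m : is_sign a -> ~~ odd m -> a ^+ m = 1.
Proof. by case=> -> m_even; rewrite ?expr1n // -signr_odd (negPf m_even). Qed.

(* For signs, [a * b - 1] and [(a - 1) + (b - 1)] differ by
   [(a - 1) * (b - 1)], a multiple of [4]. *)
Lemma sum_sign_mod4 (T : finType) (f : T -> int) : sign_valued f ->
  (\sum_x f x = #|T|%:Z + \prod_x f x - 1 %[mod 4])%Z.
Proof.
have -> : #|T|%:Z = \sum_(x : T) 1 by rewrite sumr_const natz.
move=> sf; elim: (index_enum T) => [|x s IHs]; first by rewrite !big_nil.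
rewrite !big_cons; have := is_sign_prod s xpredT sf; move: (sf x) IHs.
move: (\sum_(_ <- s) 1) (\sum_(_ <- s) _) (\prod_(_ <- s) _) => m a p.
by move=> [->|->] IHs [] p_eq; move: IHs; rewrite p_eq; lia.
Qed.

Lemma big_translate (R : Type) (idx : R) (op : Monoid.com_law idx)
    (G : finZmodType) (F : G -> R) g :
  \big[op/idx]_h F (g + h) = \big[op/idx]_h F h.
Proof. by rewrite [RHS](reindex_inj (addrI g)). Qed.

Lemma cobound_sign_valued (G : finZmodType) (phi : G -> int) g :
  sign_valued phi -> sign_valued (cobound phi g).
Proof. by move=> phi_sign h; apply: is_signM => //; apply: is_signM. Qed.

Lemma prod_cobound_row (G : finZmodType) (phi : G -> int) g :
  sign_valued phi -> \prod_h cobound phi g h = phi g ^+ #|G|.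
Proof.
move=> phi_sign; rewrite /cobound !big_split /= prodr_const -mulrA.
rewrite (big_translate _ phi) -big_split /=.
by rewrite big1 ?mulr1 // => h _; apply: is_sign_mulrr.
Qed.

Section Autocorrelation.
Variable G : finZmodType.
Implicit Types (phi : G -> int) (g h : G).

Definition autocorrelation phi g := \sum_h phi h * phi (g + h).

Lemma autocorrelationN phi g :
  autocorrelation (fun h => - phi h) g = autocorrelation phi g.
Proof. by apply: eq_bigr => h _; rewrite mulrNN. Qed.

Lemma sum_cobound_row phi g :
  \sum_h cobound phi g h = phi g * autocorrelation phi g.
Proof. by rewrite mulr_sumr; apply: eq_bigr => h _; rewrite mulrA. Qed.

Lemma sum_shifted_mul1D phi g :
  \sum_h (1 + phi h) * (1 + phi (g + h)) =
    #|G|%:Z + 2 * (\sum_h phi h) + autocorrelation phi g.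
Proof.
rewrite (eq_bigr (fun h => 1 + (phi h + phi (g + h)) + phi h * phi (g + h))).
  by rewrite !big_split sumr_const natz (big_translate _ phi) /=; ring.
by move=> h _; ring.
Qed.

Lemma shifted_mul1D_le_autocorrelation phi g h : sign_valued phi ->
  (1 + phi h) * (1 + phi (g + h)) <=
    #|G|%:Z + 2 * (\sum_x phi x) + autocorrelation phi g.
Proof.
move=> phi_sign; rewrite -sum_shifted_mul1D (bigD1 h) //= lerDl.
apply: sumr_ge0 => x _.
by have [] := phi_sign x => ->; have [] := phi_sign (g + x) => ->.
Qed.

End Autocorrelation.

Section GammaRows.
Variable k : nat.
Implicit Types g h : 'Z_k.+2.

(* Euclidean division of [g + h] by [n = k + 2], summed over [h]: the
   remainders are a permutation of the [h], so the quotients times [n] sum to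
   [n * g]. *)
Lemma sum_carry g : (\sum_(h : 'Z_k.+2) (g + h)%N %/ k.+2 = g)%N.
Proof.
have : (\sum_(h : 'Z_k.+2) (g + h) =
          \sum_(h : 'Z_k.+2) ((g + h) %/ k.+2 * k.+2 + h))%N.
  under eq_bigr do rewrite (divn_eq (g + _) k.+2).
  rewrite !big_split /=; congr addn.
  exact: (big_translate _ (@nat_of_ord _)).
rewrite !big_split /= -big_distrl /= => /addIn/eqP.
by rewrite sum_nat_const card_ord mulnC eqn_pmul2r // => /eqP.
Qed.

Lemma gamma_sign_valued g : sign_valued (gamma g).
Proof. by move=> h; apply: is_signX; right. Qed.

Lemma prod_gamma_row g : \prod_h gamma g h = (-1) ^+ (g : nat).
Proof. by rewrite -[in RHS](sum_carry g) -prodrXr. Qed.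

Lemma gamma1E h : gamma 1 h = if h == -1 then -1 else 1.
Proof.
have -> : (h == -1) = (h.+1 == k.+2 :> nat).
  by rewrite -val_eqE /= modn_small ?subn1.
rewrite /gamma add1n; case: eqP => [->|/eqP h_last]; first by rewrite divnn.
by rewrite divn_small // ltn_neqAle h_last ltn_ord.
Qed.

Lemma card_even_nonzero :
  #|[pred g : 'Z_k.+2 | (g != 0) && ~~ odd g]| = k.+1./2.
Proof.
rewrite -sum1_card big_mkcond big_ord_recl /= add0n.
under eq_bigr => j _ do rewrite inE /= add0n negbK.
rewrite -[Zp_trunc _]/k -[uphalf k]/k.+1./2.
elim: k.+1 => [|m IHm]; first by rewrite big_ord0.
by rewrite big_ord_recr /= IHm uphalf_half addnC; case: odd.
Qed.

End GammaRows.

Section GammaTimesCoboundary.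
Variables (k : nat) (phi : 'Z_k.+2 -> int) (psi : 'Z_k.+2 -> 'Z_k.+2 -> int).
Hypothesis phi_sign : sign_valued phi.
Hypothesis psiE : forall g h, psi g h = gamma g h * cobound phi g h.
Implicit Types g h : 'Z_k.+2.

Lemma gamma_cobound_sign_valued g : sign_valued (psi g).
Proof.
move=> h; rewrite psiE; apply: is_signM; first exact: gamma_sign_valued.
exact: cobound_sign_valued.
Qed.

Lemma prod_gamma_cobound_row g : ~~ odd k ->
  \prod_h psi g h = (-1) ^+ (g : nat).
Proof.
move=> k_even; under eq_bigr do rewrite psiE.
rewrite big_split /= prod_gamma_row prod_cobound_row //.
by rewrite is_sign_exp_even ?mulr1 // card_ord /= negbK.
Qed.

Lemma gamma_cobound_not_coboundary : ~~ odd k -> ~ is_coboundary psi.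
Proof.
move=> k_even [f f_sign psi_f]; have := prod_gamma_cobound_row 1 k_even.
under eq_bigr do rewrite psi_f.
by rewrite prod_cobound_row // is_sign_exp_even ?card_ord //= negbK.
Qed.

Lemma even_row_sum_ge2 g : (4 %| k)%N -> ~~ odd g -> 2 <= `|\sum_h psi g h|.
Proof.
move=> k4 g_even; have := sum_sign_mod4 (gamma_cobound_sign_valued g).
rewrite prod_gamma_cobound_row ?card_ord; last by lia.
by rewrite -signr_odd (negPf g_even) expr0 -[Zp_trunc _]/k; lia.
Qed.

Lemma odd_row_sum_eq0 g : (4 %| k)%N -> row_excess psi = k -> odd g ->
  \sum_h psi g h = 0.
Proof.
move=> k4 excess g_odd; apply/normr0_eq0.
pose even_min (x : 'Z_k.+2) : int := if ~~ odd x then 2 else 0.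
have norm_ge x : x != 0 -> 0 <= `|\sum_h psi x h| - even_min x.
  rewrite subr_ge0 /even_min; case: ifPn => // x_even _.
  exact: even_row_sum_ge2.
have sum_min : \sum_(x : 'Z_k.+2 | x != 0) even_min x = k.
  by rewrite -big_mkcondr sumr_const card_even_nonzero -mulr_natl natz; lia.
have even_min_attained := psumr_eq0P norm_ge.
rewrite sumrB -/(row_excess psi) excess sum_min subrr in even_min_attained.
have := even_min_attained erefl g; rewrite /even_min g_odd subr0; apply.
by apply: contraTneq g_odd => ->.
Qed.

Lemma sum_gamma_cobound_row1 :
  \sum_h psi 1 h = phi 1 * (autocorrelation phi 1 - 2 * (phi (-1) * phi 0)).
Proof.
under eq_bigr do rewrite psiE gamma1E.
rewrite mulrBr -sum_cobound_row [LHS](bigD1 (-1)) //= eqxx.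
rewrite [X in _ = X - _](bigD1 (-1)) //=.
rewrite (eq_bigr (cobound phi 1)); last by move=> h /negPf ->; rewrite mul1r.
by rewrite /cobound subrr; ring.
Qed.

End GammaTimesCoboundary.

Lemma quasi_orthogonal_sum_bounds (t : nat) (phi : 'Z_(4 * t).+2 -> int)
    (psi : 'Z_(4 * t).+2 -> 'Z_(4 * t).+2 -> int) :
    sign_valued phi -> phi 0 = 1 -> phi (-1) = 1 ->
    (forall g h, psi g h = gamma g h * cobound phi g h) ->
  quasi_orthogonal t psi -> - (2 * t)%:Z <= \sum_h phi h <= (2 * t + 2)%:Z.
Proof.
move=> phi_sign phi0 phiN1 psiE [_ _ excess].
have t4 : (4 %| 4 * t)%N by exact: dvdn_mulr.
have not_cob : ~ is_coboundary psi.
  by apply: (gamma_cobound_not_coboundary phi_sign psiE); lia.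
have row1 : \sum_h psi 1 h = 0.
  exact: (odd_row_sum_eq0 phi_sign psiE t4 (excess not_cob)).
have corr : autocorrelation phi 1 = 2.
  move: row1; rewrite (sum_gamma_cobound_row1 psiE) phi0 phiN1.
  by have [] := phi_sign 1 => ->; lia.
have phiN_sign : sign_valued (fun h => - phi h).
  by move=> h; apply: is_signN.
have := shifted_mul1D_le_autocorrelation 1 (-1) phi_sign.
have := shifted_mul1D_le_autocorrelation 1 (-1) phiN_sign.
rewrite autocorrelationN sumrN subrr phi0 phiN1 corr card_ord.
rewrite -[Zp_trunc _]/(4 * t)%N; move: (\sum_h phi h) => s; lia.
Qed.

Section DeltaProduct.
Variables (k w : nat) (i : 'I_w -> nat).
Implicit Types x g h : 'Z_k.+2.

Definition delta_prod x : int := \prod_(j < w) delta (i j) x.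

Lemma gamma_prodE g h : gamma_prod i g h = gamma g h * cobound delta_prod g h.
Proof. by rewrite /gamma_prod /cobound /delta_prod -!big_split. Qed.

Lemma delta_prod_sign_valued : sign_valued delta_prod.
Proof.
move=> x; apply: is_sign_prod => j.
by rewrite /delta; case: eqP; [right | left].
Qed.

Lemma delta_prod_eq1 x : (forall j, x.+1 != i j) -> delta_prod x = 1.
Proof. by move=> xi; apply: big1 => j _; rewrite /delta (negPf (xi j)). Qed.

Lemma delta_prodE x : injective i ->
  delta_prod x = 1 - 2 * \sum_j (x.+1 == i j)%:R.
Proof.
move=> i_inj; have [j /eqP xj|xi] := pickP (fun j => x.+1 == i j).
  have x_neq l : l != j -> x.+1 != i l by rewrite xj (inj_eq i_inj) eq_sym.
  rewrite /delta_prod (bigD1 j) //= [X in 2 * X](bigD1 j) //= /delta xj eqxx.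
  by rewrite -xj !big1 // => l /x_neq /negPf ->.
by rewrite delta_prod_eq1 ?big1 ?mulr0 ?subr0 // => j *; rewrite xi.
Qed.

Lemma sum_delta_prod : injective i -> (forall j, 0 < i j <= k.+2)%N ->
  \sum_x delta_prod x = k.+2%:Z - 2 * w%:Z.
Proof.
move=> i_inj i_range; under eq_bigr do rewrite delta_prodE //.
rewrite sumrB -mulr_sumr sumr_const card_ord exchange_big /=.
rewrite (eq_bigr (fun=> 1)) => [|j _].
  by rewrite sumr_const card_ord !natz.
have /andP[ij_gt0 ij_le] := i_range j.
have ij_lt : ((i j).-1 < k.+2)%N by rewrite prednK.
rewrite (bigD1 (Ordinal ij_lt)) //= prednK // eqxx big1 // => x.
by rewrite -val_eqE /= -eqSS prednK // => /negPf ->.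
Qed.

End DeltaProduct.

Local Close Scope ring_scope.

Theorem corollary2 (t : nat) (ht : 1 <= t) (w : nat) (i : 'I_w -> nat)
    (hinj : injective i) (hi : forall j, 2 <= i j <= 4 * t + 1) :
  quasi_orthogonal t (@gamma_prod (4 * t).+2 w i) -> t <= w <= 3 * t + 1.
Proof.
have delta0 : delta_prod i (0%R : 'Z_(4 * t).+2) = 1%R.
  by apply: delta_prod_eq1 => j; have := hi j; case: eqP => // <-.
have deltaN1 : delta_prod i (-1 : 'Z_(4 * t).+2)%R = 1%R.
  apply: delta_prod_eq1 => j; have := hi j; case: eqP => //= <-.
  by rewrite modn_small subn1 // addn1 ltnn.
have i_range j : 0 < i j <= (4 * t).+2 by have := hi j; lia.
move=> /(quasi_orthogonal_sum_bounds (delta_prod_sign_valued i) delta0 deltaN1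
           (gamma_prodE i)).
by rewrite (sum_delta_prod hinj i_range); lia.
Qed.
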